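(* Let $R$ be a finite chain ring with maximal ideal $\langle\gamma\rangle$, even index of nilpotency $e$ of $\gamma$, and residue field $K$ with $|K|=p^r$ ($p$ prime), so $|R|=p^{er}$. Let $n$ be a positive integer with $\gcd(n,p)=1$. Then there exists a non-trivial cyclic self-dual code of length $n$ over $R$ if and only if $(p^r)^i\not\equiv -1\pmod n$ for all positive integers $i$.
   Context: A finite chain ring is a finite commutative local ring whose ideals are linearly ordered; its maximal ideal is principal, generated by a nilpotent $\gamma$ whose nilpotency index is $e$, and $K=R/\langle\gamma\rangle$ is its residue field. A code of length $n$ over $R$ is an $R$-submodule of $R^n$; it is cyclic if closed under the cyclic shift $(c_0,\dots,c_{n-1})\mapsto(c_{n-1},c_0,\dots,c_{n-2})$. The dual is $C^\perp=\{u\in R^n:\sum u_iv_i=0\ \forall v\in C\}$ and $C$ is self-dual if $C=C^\perp$. When $e$ is even, $\gamma^{e/2}R^n$ (generated by $\gamma^{e/2}I_n$) is a self-dual cyclic code, called the trivial self-dual code; a non-trivial self-dual code is a self-dual code different from it. *)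

(* Defs.v *)
From HB Require Import structures.
From mathcomp Require Import all_boot all_order all_algebra.
Set Implicit Arguments. Unset Strict Implicit. Unset Printing Implicit Defensive.
Import Order.TTheory GRing.Theory Num.Theory.
Local Open Scope ring_scope.

Section ChainRing.
Variable R : finComUnitRingType.

Definition is_ideal (I : {set R}) : bool :=
  [&& 0 \in I,
      [forall x in I, forall y in I, x + y \in I] &
      [forall a : R, forall x in I, a * x \in I]].

Definition principal_ideal (g : R) : {set R} := [set g * a | a : R].

(* the set of non-units; R is local iff it is an ideal (then it is the
   unique maximal ideal) *)
Definition nonunits : {set R} := [set x | x \isn't a GRing.unit].

Definition is_local_ring : bool := is_ideal nonunits.

Definition is_chain_ring : bool :=
  is_local_ring &&
  [forall I : {set R}, forall J : {set R},
     (is_ideal I && is_ideal J) ==> ((I \subset J) || (J \subset I))].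

Definition nilpotency_index (g : R) (e : nat) : Prop :=
  g ^+ e = 0 /\ forall k, (k < e)%N -> g ^+ k != 0.

(* the residue field K = R / <g>, as the set of additive cosets of <g> *)
Definition residue_classes (g : R) : {set {set R}} :=
  [set [set x + m | m in principal_ideal g] | x : R].

Definition is_code (n : nat) (C : {set 'rV[R]_n}) : bool :=
  [&& 0 \in C,
      [forall u in C, forall v in C, u + v \in C] &
      [forall a : R, forall v in C, a *: v \in C]].

(* cyclic shift (c_0,...,c_{n-1}) |-> (c_{n-1}, c_0, ..., c_{n-2}) *)
Definition cshift (n : nat) (v : 'rV[R]_n) : 'rV[R]_n :=
  \row_(i < n) v 0 (ord_pred i).

Definition is_cyclic_code (n : nat) (C : {set 'rV[R]_n}) : bool :=
  is_code C && [forall v in C, cshift v \in C].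

Definition inner (n : nat) (u v : 'rV[R]_n) : R := \sum_(i < n) u 0 i * v 0 i.

Definition dual_code (n : nat) (C : {set 'rV[R]_n}) : {set 'rV[R]_n} :=
  [set u | [forall v in C, inner u v == 0]].

Definition self_dual (n : nat) (C : {set 'rV[R]_n}) : bool := C == dual_code C.

Definition trivial_code (n : nat) (g : R) (e : nat) : {set 'rV[R]_n} :=
  [set g ^+ (e./2) *: v | v : 'rV[R]_n].

End ChainRing.

(* Main.v *)
(** Write q = |K| and S = R[x]/(x^n - 1).  Cyclic codes of length n are the
    ideals of S, and the dual of an ideal C is the set of all u such that
    u v^* = 0 for every v in C, where * is the involution x |-> x^-1.

    If q^i = -1 mod n, then v^* = v^(q^i) modulo gamma, and S/gamma is reduced
    because v^(q^(2i)) = v there.  Hence u = gamma^k v in a self-dual code with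
    k < e/2 forces v v^* = 0 modulo gamma, so v = 0 modulo gamma: the code lies
    in gamma^(e/2) S, and equals it by duality.

    Otherwise let b be the sum of the x^(q^i) over one period.  Modulo gamma,
    b^q = b but b^* <> b.  If all the idempotents (b - c)^(q-1), for c in K,
    were fixed by *, then (b - b^* ) (b - c)^(q-1) = b - b^* for every c, and
    the product over c, which contains the factor b^q - b = 0, would give
    b = b^*.  So S/gamma has an idempotent E with E^* <> E.  Taking p-power
    powers lifts it to S, and a = E (1 - E^* ) satisfies a a^* = 0.  With
    d = 1 - a - a^*, the ideal generated by gamma^(e/2-1) a, gamma^(e/2+1) a^*
    and gamma^(e/2) d is self-dual and non-trivial. *)

Require Import Defs.
From HB Require Import structures.
From mathcomp Require Import all_boot all_order all_algebra.
From mathcomp Require Import ring zify qpoly cyclic.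
Set Implicit Arguments. Unset Strict Implicit. Unset Printing Implicit Defensive.
Import Order.TTheory GRing.Theory Num.Theory.
Local Open Scope ring_scope.

(** * Congruence modulo a principal ideal *)

Section Congruence.
Variable A : comNzRingType.
Implicit Types g x y z : A.

Definition cong g x y := exists w, x - y = g * w.

Lemma cong_refl g x : cong g x x.
Proof. by exists 0; rewrite subrr mulr0. Qed.

Lemma cong_sym g x y : cong g x y -> cong g y x.
Proof. by case=> w h; exists (- w); rewrite mulrN -h opprB. Qed.

Lemma cong_trans g y x z : cong g x y -> cong g y z -> cong g x z.
Proof.
by move=> [w hw] [w' hw']; exists (w + w'); rewrite mulrDr -hw -hw' addrA subrK.
Qed.

Lemma congD g x y x' y' : cong g x y -> cong g x' y' -> cong g (x + x') (y + y').
Proof.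
by move=> [w hw] [w' hw']; exists (w + w'); rewrite mulrDr -hw -hw'; ring.
Qed.

Lemma congN g x y : cong g x y -> cong g (- x) (- y).
Proof. by case=> w h; exists (- w); rewrite mulrN -h opprD. Qed.

Lemma congB g x y x' y' : cong g x y -> cong g x' y' -> cong g (x - x') (y - y').
Proof. by move=> h /congN; apply: congD. Qed.

Lemma congM g x y x' y' : cong g x y -> cong g x' y' -> cong g (x * x') (y * y').
Proof.
move=> [w hw] [w' hw']; exists (w * x' + w' * y).
have -> : x * x' - y * y' = (x - y) * x' + (x' - y') * y by ring.
by rewrite hw hw'; ring.
Qed.

Lemma congX g x y k : cong g x y -> cong g (x ^+ k) (y ^+ k).
Proof.
move=> h; elim: k => [|k IH]; first exact: cong_refl.
by rewrite !exprS; apply: congM.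
Qed.

Lemma cong_sum g (I : Type) (s : seq I) (P : pred I) (F G : I -> A) :
  (forall i, P i -> cong g (F i) (G i)) ->
  cong g (\sum_(i <- s | P i) F i) (\sum_(i <- s | P i) G i).
Proof.
by move=> h; apply: (big_rec2 _ (cong_refl g 0)) => i u v /h; apply: congD.
Qed.

Lemma cong_prod g (I : Type) (s : seq I) (P : pred I) (F G : I -> A) :
  (forall i, P i -> cong g (F i) (G i)) ->
  cong g (\prod_(i <- s | P i) F i) (\prod_(i <- s | P i) G i).
Proof.
by move=> h; apply: (big_rec2 _ (cong_refl g 1)) => i u v /h; apply: congM.
Qed.

Lemma cong0M g x y : cong g x 0 -> cong g (x * y) 0.
Proof. by case=> w; rewrite subr0 => ->; exists (w * y); rewrite subr0 mulrA. Qed.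

Lemma cong_dvd g h x y : cong (g * h) x y -> cong g x y.
Proof. by case=> w hw; exists (h * w); rewrite hw mulrA. Qed.

Lemma cong_iterX g x k j : cong g (x ^+ k) x -> cong g (x ^+ (k ^ j)) x.
Proof.
move=> h; elim: j => [|j IH]; first exact: cong_refl.
by rewrite expnS exprM; apply: (cong_trans (congX _ h)).
Qed.

(** * Frobenius powers when a prime [p] vanishes modulo [g] *)

Section PrimePower.
Variables (g : A) (p : nat).
Hypotheses (p_pr : prime p) (gp : cong g p%:R 0).

(* x^p - y^p = (x - y) * sum, where the sum is p y^(p-1) = 0 modulo g. *)
Lemma cong_expp k x y : cong (g ^+ k.+1) x y -> cong (g ^+ k.+2) (x ^+ p) (y ^+ p).
Proof.
move=> h; have h1 : cong g x y by apply: (@cong_dvd g (g ^+ k)); rewrite -exprS.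
have : cong g (\sum_(i < p) x ^+ (p.-1 - i) * y ^+ i) 0.
  apply: (@cong_trans g (\sum_(i < p) y ^+ p.-1)).
    apply: cong_sum => i _.
    have <- : y ^+ (p.-1 - i) * y ^+ i = y ^+ p.-1.
      by rewrite -exprD subnK // -ltnS (prednK (prime_gt0 p_pr)).
    by apply: congM; [apply: congX | exact: cong_refl].
  by rewrite sumr_const card_ord -mulr_natl; apply: cong0M.
case=> w; rewrite subr0 => hw; case: h => w' hw'.
by exists (w * w'); rewrite subrXX hw' hw [g ^+ k.+2]exprSr; ring.
Qed.

(** Each p-th power gains a factor [g], so after [N] of them the two sides agree modulo [g ^+ N.+1],
    which is 0. This turns identities modulo gamma into exact ones. *)
Lemma cong_exp_nilp e N x y : g ^+ e = 0 -> (e <= N)%N -> cong g x y ->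
  x ^+ (p ^ N) = y ^+ (p ^ N).
Proof.
move=> ge leN h.
have : cong (g ^+ N.+1) (x ^+ (p ^ N)) (y ^+ (p ^ N)).
  elim: {leN} N => [|N IH]; first by rewrite expr1 !expr1.
  by rewrite expnSr !exprM; apply: cong_expp.
have -> : g ^+ N.+1 = 0 by rewrite -(subnK (leqW leN)) exprD ge mulr0.
by case=> w /eqP; rewrite mul0r subr_eq0 => /eqP.
Qed.

Lemma cong_frobD x y : cong g ((x + y) ^+ p) (x ^+ p + y ^+ p).
Proof.
have [m pm] : exists m, p = m.+1 by exists p.-1; rewrite (prednK (prime_gt0 p_pr)).
rewrite exprDn pm big_ord_recl big_ord_recr /= subn0 bin0 subnn binn !mulr1n mul1r mulr1.
apply: (@cong_trans _ (x ^+ m.+1 + (0 + y ^+ m.+1))); last by rewrite add0r; apply: cong_refl.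
apply: congD (cong_refl _ _) _; apply: congD; last exact: cong_refl.
apply: (@cong_trans _ (\sum_(i < m) 0)); last by rewrite big1 //; apply: cong_refl.
apply: cong_sum => i _.
have /dvdnP[c ->] : (p %| 'C(m.+1, bump 0 i))%N.
  by rewrite -pm prime_dvd_bin // /bump /= add1n pm ltnS ltn_ord.
rewrite -mulr_natl natrM mulrC mulrA; rewrite mulrC; exact: cong0M.
Qed.

Lemma cong_frob_sum (I : Type) (s : seq I) (P : pred I) (F : I -> A) N :
  cong g ((\sum_(i <- s | P i) F i) ^+ (p ^ N)) (\sum_(i <- s | P i) F i ^+ (p ^ N)).
Proof.
elim: N => [|N IH]; first exact: cong_refl.
rewrite expnSr exprM; apply: cong_trans (congX _ IH) _.
under [X in cong g _ X]eq_bigr do rewrite exprM.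
elim/big_rec2: _ => [|i u v _ h]; first by rewrite expr0n gtn_eqF ?prime_gt0 //; exact: cong_refl.
by apply: cong_trans (cong_frobD _ _) _; apply: congD h; apply: cong_refl.
Qed.

End PrimePower.
End Congruence.

(** * Arithmetic of the chain ring and its residue field *)

Section ChainRing.
Variables (R : finComUnitRingType) (gamma : R) (e : nat).
Hypothesis gamma_max : nonunits R = principal_ideal gamma.
Hypothesis gamma_nilp : nilpotency_index gamma e.

Lemma in_principal_ideal a : reflect (cong gamma a 0) (a \in principal_ideal gamma).
Proof.
apply: (iffP imsetP) => [[w _ ->]|[w]]; first by exists w; rewrite subr0.
by rewrite subr0 => ->; exists w.
Qed.

Lemma nonunitP a : reflect (cong gamma a 0) (a \isn't a GRing.unit).
Proof.
have <- : (a \in nonunits R) = (a \isn't a GRing.unit) by rewrite inE.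
by rewrite gamma_max; apply: in_principal_ideal.
Qed.

Lemma cong_unit a b : cong gamma a b -> (a \is a GRing.unit) = (b \is a GRing.unit).
Proof.
move=> h; apply: negb_inj; apply/nonunitP/nonunitP; last exact: cong_trans.
exact: cong_trans (cong_sym h).
Qed.

Lemma nilpotency_index_gt0 : (0 < e)%N.
Proof.
case: gamma_nilp; case: e => // /eqP; by rewrite expr0 oner_eq0.
Qed.

(** Factors gamma are extracted one at a time: if [a = gamma ^+ j * w] with [w] a unit, then
    [gamma ^+ (k + j) = 0] with [k + j < e], against the nilpotency index. *)
Lemma annihilator_gammaX k a : (k <= e)%N -> gamma ^+ k * a = 0 ->
  exists w, a = gamma ^+ (e - k) * w.
Proof.
case: gamma_nilp => ge gk.
move=> ke ka; suff: forall j, (j <= e - k)%N -> exists w, a = gamma ^+ j * w by apply.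
elim=> [|j IH] hj; first by exists a; rewrite mul1r.
have [w aw] := IH (ltnW hj).
have [/unitrP[v [vw wv]]|/nonunitP[w']] := boolP (w \is a GRing.unit).
  have /gk/negP[] : (k + j < e)%N by rewrite -ltn_subRL.
  by apply/eqP; rewrite -[LHS]mulr1 -wv mulrA exprD -[_ * w]mulrA -aw ka mul0r.
by rewrite subr0 => hw; exists w'; rewrite aw hw mulrA exprSr.
Qed.

(** The residue field is given only as a set of cosets; its arithmetic is carried out on
    representatives in [R], up to congruence. *)
Lemma residue_transversal : exists2 T : {set R}, #|T| = #|residue_classes gamma| &
  (forall a, exists2 c, c \in T & cong gamma a c) /\
  {in T &, forall c d, cong gamma c d -> c = d}.
Proof.
pose cl x : {set R} := [set x + m | m in principal_ideal gamma].
have clP x y : reflect (cong gamma y x) (y \in cl x).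
  apply: (iffP imsetP) => [[m /in_principal_ideal[w hw] ->]|h].
    by exists w; rewrite -hw addrC addKr subr0.
  exists (y - x); last by rewrite addrC subrK.
  by apply/in_principal_ideal; case: h => w ->; exists w; rewrite subr0.
have eq_cl x y : cong gamma x y -> cl x = cl y.
  move=> h; apply/setP=> z; apply/clP/clP => hz; apply: cong_trans hz _ => //.
  exact: cong_sym.
pose rep (C : {set R}) := odflt 0 [pick y in C].
have repP x : cong gamma (rep (cl x)) x.
  rewrite /rep; case: pickP => [y /clP //|/(_ x)].
  by have -> : x \in cl x by apply/clP; apply: cong_refl.
exists (rep @: residue_classes gamma); last split.
- rewrite card_in_imset // => _ _ /imsetP[x _ ->] /imsetP[y _ ->] h.
  by apply: eq_cl; apply: cong_trans (repP y); rewrite -h; apply/cong_sym/repP.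
- move=> a; exists (rep (cl a)); last by apply/cong_sym/repP.
  by rewrite imset_f // imset_f.
- move=> _ _ /imsetP[_ /imsetP[x _ ->] ->] /imsetP[_ /imsetP[y _ ->] ->] h.
  congr rep; apply: eq_cl; apply: cong_trans (repP y); apply: cong_trans h.
  exact/cong_sym/repP.
Qed.

(** Lets a sum or product over representatives be reindexed along translation by 1 or multiplication
    by a unit. *)
Lemma transversal_permute (T : {set R}) (f : R -> R) :
  {in T &, forall c d, cong gamma c d -> c = d} ->
  {in T, forall c, exists2 d, d \in T & cong gamma (f c) d} ->
  {in T &, forall c d, cong gamma (f c) (f d) -> cong gamma c d} ->
  exists h : R -> R, [/\ {in T &, injective h}, h @: T = T
    & {in T, forall c, cong gamma (f c) (h c)}].
Proof.
move=> Tinj Tf finj.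
have [h hP] : exists h : R -> R, forall c, c \in T -> (h c \in T) /\ cong gamma (f c) (h c).
  apply: (@fin_all_exists _ (fun=> R) (fun c d => c \in T -> d \in T /\ cong gamma (f c) d)) => c.
  have [/Tf[d dT cd]|_] := boolP (c \in T); first by exists d.
  by exists c.
have hinj : {in T &, injective h}.
  move=> c d cT dT hcd; apply: Tinj => //; apply: finj => //.
  have [_ h1] := hP c cT; have [_ h2] := hP d dT.
  by apply: cong_trans h1 _; rewrite hcd; apply: cong_sym.
exists h; split=> //; last by move=> c /hP[].
apply/eqP; rewrite eqEcard card_in_imset // leqnn andbT.
by apply/subsetP=> _ /imsetP[c /hP[? _] ->].
Qed.

(** Translation by 1 permutes the residue field, so the sum of its elements is unchanged when |K| is
    added to it. *)
Lemma cong_card_residue : cong gamma #|residue_classes gamma|%:R 0.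
Proof.
have [T <- [Tex Tinj]] := residue_transversal.
have [||h [hinj hT hf]] := @transversal_permute T (fun c => c + 1) Tinj.
- by move=> c _; apply: Tex.
- move=> c d _ _ /congB /(_ (cong_refl _ 1)); by rewrite !addrK.
have : cong gamma (\sum_(c in T) (c + 1)) (\sum_(c in T) c).
  rewrite -{2}hT big_imset //=; exact: cong_sum.
move=> /congB /(_ (cong_refl _ (\sum_(c in T) c))).
by rewrite subrr big_split /= addrAC subrr add0r sumr_const.
Qed.

Lemma cong_pchar p r : #|residue_classes gamma| = (p ^ r)%N -> cong gamma p%:R 0.
Proof.
move=> hq; apply/nonunitP; apply/negP => pu.
by have /nonunitP/negP[] := cong_card_residue; rewrite hq natrX unitrX.
Qed.

(** Multiplication by a unit [a] permutes the nonzero classes; cancelling their product, a unit,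
    leaves [a ^+ (q - 1)] congruent to 1. *)
Lemma cong_fermat a : cong gamma (a ^+ #|residue_classes gamma|) a.
Proof.
have [T Tq [Tex Tinj]] := residue_transversal; rewrite -Tq.
have T_gt0 : (0 < #|T|)%N by have [c cT _] := Tex 0; rewrite (cardD1 c) cT.
have [ua|/nonunitP ca] := boolP (a \is a GRing.unit); last first.
  apply: cong_trans (congX _ ca) _; rewrite expr0n gtn_eqF //; exact: cong_sym.
pose U := [set c in T | c \is a GRing.unit].
have UT : {subset U <= T} by move=> c; rewrite inE => /andP[].
(* Exactly one representative is a nonunit: the one of the zero class. *)
have cU : #|T| = #|U|.+1.
  have [z zT /cong_sym/nonunitP zn] := Tex 0.
  rewrite (cardsD1 z) zT add1n; congr _.+1; apply: eq_card => c.
  rewrite !inE andbC; case cT: (c \in T) => //=.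
  apply/idP/idP => [|cu]; last by apply: contraNneq zn => <-.
  apply: contraR => /nonunitP c0; apply/eqP; apply: Tinj => //.
  by apply: cong_trans c0 _; apply/cong_sym/nonunitP.
have [|||h [hinj hU hf]] := @transversal_permute U (fun c => a * c).
- by move=> c d /UT cT /UT dT; apply: Tinj.
- move=> c; rewrite inE => /andP[_ cu]; have [d dT hd] := Tex (a * c).
  by exists d => //; rewrite inE dT -(cong_unit hd) unitrM ua.
- move=> c d _ _ /(congM (cong_refl gamma a^-1)); by rewrite !mulKr.
have : cong gamma (\prod_(c in U) (a * c)) (\prod_(c in U) c).
  rewrite -{2}hU big_imset //=; exact: cong_prod.
have Pu : \prod_(c in U) c \is a GRing.unit.
  by rewrite rpred_prod // => c; rewrite inE => /andP[].
move=> /congM /(_ (cong_refl _ (\prod_(c in U) c)^-1)).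
rewrite big_split /= mulrK // divrr // prodr_const => aU.
by rewrite cU exprS -[X in cong _ _ X]mulr1; apply: congM aU; apply: cong_refl.
Qed.

Lemma card_residue_gt1 p r :
  prime p -> #|residue_classes gamma| = (p ^ r)%N -> (1 < p ^ r)%N.
Proof.
move=> p_pr hq; rewrite ltn_neqAle expn_gt0 prime_gt0 // andbT eq_sym -hq.
apply/negP => /eqP h1; have := cong_card_residue; rewrite h1 => /nonunitP.
by rewrite unitr1.
Qed.

(** The roots are Teichmuller lifts: [t c] is congruent to [c], and [t c ^+ q = t c] holds exactly.
    There are q of them and their differences are units, which is enough to split the polynomial
    although [R] need not be a domain. *)
Lemma prod_teichmuller p r : prime p -> #|residue_classes gamma| = (p ^ r)%N ->
  exists s : seq R, 'X^(p ^ r) - 'X = \prod_(c <- s) ('X - c%:P).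
Proof.
move=> p_pr hq; have cp := cong_pchar hq.
have q_gt1 := card_residue_gt1 p_pr hq.
have r_gt0 : (0 < r)%N by rewrite lt0n; apply: contraTneq q_gt1 => ->.
have [T Tq [Tex Tinj]] := residue_transversal.
pose t (c : R) := c ^+ (p ^ (r * e)).
have tc c : cong gamma (t c) c.
  by rewrite /t expnM; apply: cong_iterX; rewrite -hq; apply: cong_fermat.
exists [seq t c | c <- enum T].
have sq : size ('X^(p ^ r) - 'X : {poly R}) = (p ^ r).+1.
  by rewrite size_polyDl ?size_polyXn // size_polyN size_polyX.
rewrite [LHS](@all_roots_prod_XsubC _ _ [seq t c | c <- enum T]).
- rewrite lead_coefDl ?size_polyXn ?size_polyN ?size_polyX //.
  by rewrite lead_coefXn scale1r.
- by rewrite sq size_map -cardE Tq hq.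
- apply/allP => _ /mapP[c _ ->]; rewrite rootE !hornerE subr_eq0 /t exprAC.
  apply/eqP; apply: (cong_exp_nilp p_pr cp gamma_nilp.1); first exact: leq_pmull.
  by rewrite -hq; apply: cong_fermat.
- have: {subset enum T <= T} by move=> c; rewrite mem_enum.
  have: uniq (enum T) by apply: enum_uniq.
  elim: (enum T) => //= c s IH /andP[cs us] sT; apply/andP; split; last first.
    by apply: IH => // d ds; apply: sT; rewrite inE ds orbT.
  apply/allP => _ /mapP[d ds ->]; rewrite /diff_roots mulrC eqxx /=.
  apply: contraR cs => /nonunitP h.
  suff -> : c = d by [].
  apply: Tinj; rewrite ?sT ?inE ?eqxx ?ds ?orbT //; apply: cong_sym.
  apply: cong_trans (cong_sym (tc d)) _; apply: cong_trans (tc c).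
  by case: h => w; rewrite subr0 => h; exists w.
Qed.

End ChainRing.

(** * The algebra R[x]/(x^n - 1), its involution and its trace form *)

Section CyclicAlgebra.
Variables (R : finComUnitRingType) (m : nat).
Notation n := m.+1.

Definition cyc_mod : {poly R} := 'X^n - 1.
Definition cyc_alg := {poly %/ cyc_mod}.
HB.instance Definition _ := GRing.ComAlgebra.on cyc_alg.

Notation S := cyc_alg.

Definition cycX : S := in_qpoly cyc_mod 'X.
Definition cyc_tr (u : S) : R := (u : {poly R})`_0.
Definition of_row (v : 'rV[R]_n) : S := \sum_(i < n) v 0 i *: cycX ^+ i.
(* [cycX ^+ m] is the inverse of [cycX]: this is the involution x |-> x^-1. *)
Definition star (u : S) : S := horner_alg (cycX ^+ m) (u : {poly R}).

Lemma size_cyc_mod : size cyc_mod = n.+1.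
Proof. by rewrite /cyc_mod -polyC1 size_XnsubC. Qed.

Lemma monic_cyc : cyc_mod \is monic.
Proof. by rewrite /cyc_mod -polyC1 monicXnsubC. Qed.

(** The quotient type reduces modulo [mk_monic] of the given polynomial, which is the polynomial
    itself only if it is monic of positive degree; hence n is written [m.+1]. *)
Lemma mk_monic_cyc : mk_monic cyc_mod = cyc_mod.
Proof. by rewrite /mk_monic size_cyc_mod monic_cyc. Qed.

Lemma cycXn : cycX ^+ n = 1.
Proof.
rewrite /cycX -rmorphXn /= -[_ ^+ n](subrK 1) rmorphD rmorph1.
have h : in_qpoly cyc_mod cyc_mod = 0.
  by apply: val_inj; rewrite /= mk_monic_cyc; rewrite Pdiv.RingMonic.rmodpp ?monic_cyc.
by rewrite [X in X + _]h add0r.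
Qed.

Lemma cycXE k : (k < n)%N -> cycX ^+ k = 'X^k :> {poly R}.
Proof.
move=> kn; have -> : cycX ^+ k = in_qpoly cyc_mod 'X^k by rewrite rmorphXn.
by rewrite in_qpoly_small // mk_monic_cyc size_cyc_mod size_polyXn.
Qed.

Lemma cyc_tr_is_linear : scalar cyc_tr.
Proof. by move=> a u v; rewrite /cyc_tr /= coefD coefZ. Qed.
HB.instance Definition _ := GRing.isLinear.Build R S R _ cyc_tr cyc_tr_is_linear.

Lemma cyc_trX k : cyc_tr (cycX ^+ k) = (n %| k)%:R.
Proof.
rewrite -(expr_mod k cycXn) /cyc_tr cycXE ?ltn_mod //.
by rewrite coefXn /dvdn eq_sym.
Qed.

Lemma of_row_is_linear : linear of_row.
Proof.
move=> a u v; rewrite /of_row scaler_sumr -big_split /=; apply: eq_bigr => i _.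
by rewrite !mxE scalerDl scalerA.
Qed.
HB.instance Definition _ := GRing.isLinear.Build R 'rV[R]_n S _ of_row of_row_is_linear.

(** Multiplication by [cycX ^+ (n - i)], the inverse of [cycX ^+ i], moves coefficient i to the
    constant term. Nondegeneracy of the trace form follows. *)
Lemma cyc_tr_of_row v (i : 'I_n) : cyc_tr (cycX ^+ (n - i) * of_row v) = v 0 i.
Proof.
rewrite /of_row mulr_sumr raddf_sum (bigD1 i) //= -scalerAr linearZ /= -exprD.
rewrite subnK 1?ltnW // cyc_trX dvdnn mulr1 big1 ?addr0 // => j ji.
rewrite -scalerAr linearZ /= -exprD cyc_trX.
suff -> : (n %| n - i + j)%N = false by rewrite mulr0.
apply: contraNF ji => h; apply/eqP/val_inj => /=.
have /eqP : i = j %[mod n].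
  apply/eqP; rewrite -(eqn_modDl (n - i)) subnK 1?ltnW // modnn eq_sym; exact: h.
by rewrite !modn_small // => /eqP.
Qed.

Lemma of_row_surj u : exists v, u = of_row v.
Proof.
exists (\row_i (u : {poly R})`_i); apply: val_inj.
have su : (size (u : {poly R}) <= n)%N.
  by rewrite -ltnS -size_cyc_mod -[in X in (_ < X)%N]mk_monic_cyc size_mk_monic.
rewrite /of_row [RHS]poly_of_qpoly_sum -[LHS]coefK poly_def.
apply: etrans (_ : \sum_(i < n) u`_i *: 'X^i = _); last first.
  by apply: eq_bigr => i _; rewrite poly_of_qpolyZ cycXE // mxE.
rewrite -[RHS](big_mkord xpredT (fun i => u`_i *: 'X^i)) (big_cat_nat _ su) //=.
rewrite big_mkord [X in _ = _ + X]big_nat_cond [X in _ = _ + X]big1 ?addr0 //.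
by move=> i /andP[/andP[hi _] _]; rewrite nth_default ?scale0r.
Qed.

Lemma cyc_alg_ext u v :
  (forall k, cyc_tr (cycX ^+ k * u) = cyc_tr (cycX ^+ k * v)) -> u = v.
Proof.
have [u' ->] := of_row_surj u; have [v' ->] := of_row_surj v => h.
congr of_row; apply/rowP => i; by rewrite -!cyc_tr_of_row.
Qed.

Lemma of_row_inj : injective of_row.
Proof. by move=> u v h; apply/rowP => i; rewrite -!cyc_tr_of_row h. Qed.

Lemma star_is_linear : linear star.
Proof. by move=> a u v; rewrite /star /= linearP /= mulr_algl. Qed.
HB.instance Definition _ := GRing.isLinear.Build R S S _ star star_is_linear.

(** [star] evaluates the reduced representative; it is multiplicative because [cycX ^+ m] is a root
    of the modulus. *)
Lemma horner_alg_rmodp (p : {poly R}) :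
  horner_alg (cycX ^+ m) (Pdiv.CommonRing.rmodp p cyc_mod) = horner_alg (cycX ^+ m) p.
Proof.
rewrite [in RHS](Pdiv.RingMonic.rdivp_eq monic_cyc p) rmorphD rmorphM /=.
suff -> : horner_alg (cycX ^+ m) cyc_mod = 0 by rewrite mulr0 add0r.
by rewrite rmorphB rmorph1 rmorphXn /= horner_algX exprAC cycXn expr1n subrr.
Qed.

Lemma star_is_monoid_morphism : monoid_morphism star.
Proof.
split=> [|u v]; first by rewrite /star qpolyCE rmorph1.
rewrite /star -rmorphM -[RHS]horner_alg_rmodp; congr (horner_alg _ _).
rewrite [LHS]poly_of_qpolyM; congr Pdiv.CommonRing.rmodp; exact: mk_monic_cyc.
Qed.
HB.instance Definition _ := GRing.isMonoidMorphism.Build S S star star_is_monoid_morphism.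

Lemma star_alg (c : R) : star c%:A = c%:A.
Proof. by rewrite linearZ /= rmorph1. Qed.

Lemma starX k : star (cycX ^+ k) = cycX ^+ (m * k).
Proof.
rewrite rmorphXn /= exprM; congr (_ ^+ _).
by rewrite /star /cycX /= mk_monic_cyc horner_alg_rmodp horner_algX.
Qed.

Lemma starK : involutive star.
Proof.
move=> u; have [v ->] := of_row_surj u; rewrite /of_row !rmorph_sum /=.
apply: eq_bigr => i _; rewrite !linearZ /= !starX; congr (_ *: _).
rewrite mulnA exprM; congr (_ ^+ _).
have h : cycX * cycX ^+ m = 1 by rewrite -exprS cycXn.
(* With y = x^m the inverse of x: y^m = x y y^m = x y^n = x. *)
rewrite exprM -[LHS]mul1r -h -mulrA -exprS exprAC cycXn expr1n mulr1 //.
Qed.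

Lemma of_row_cshift v : of_row (cshift v) = cycX * of_row v.
Proof.
rewrite /of_row mulr_sumr (reindex_inj (@ordS_inj n)) /=; apply: eq_bigr => i _.
by rewrite mxE ordSK -scalerAr -exprS (expr_mod i.+1 cycXn).
Qed.

(** The product of x^i and the star of x^j is x^(i + m j), whose trace is 1 exactly when i = j,
    since m is -1 modulo n. *)
Lemma inner_of_row u v : inner u v = cyc_tr (of_row u * star (of_row v)).
Proof.
rewrite /inner /of_row mulr_suml raddf_sum; apply: eq_bigr => i _.
rewrite rmorph_sum mulr_sumr raddf_sum (bigD1 i) //= linearZ /= starX.
rewrite -scalerAl -scalerAr -exprD -mulSn !linearZ /= cyc_trX dvdn_mulr // mulr1.
rewrite big1 ?addr0 // => j ji; rewrite linearZ /= starX.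
rewrite -scalerAl -scalerAr -exprD !linearZ /= cyc_trX.
suff -> : (n %| i + m * j)%N = false by rewrite !mulr0.
apply: contraNF ji => h; apply/eqP/val_inj => /=.
have /eqP : i = j %[mod n].
  apply/eqP; rewrite -(eqn_modDr (m * j)) -mulSn modnMr; exact: h.
by rewrite !modn_small // => /eqP.
Qed.

End CyclicAlgebra.

(** * Cyclic codes as ideals, and their duals *)

Section CyclicCodes.
Variables (R : finComUnitRingType) (m : nat).
Notation n := m.+1.
Notation S := (cyc_alg R m).
Notation x := (cycX R m).
Implicit Types (C : {set 'rV[R]_n}) (u v : 'rV[R]_n).

Lemma is_codeP C : reflect
  [/\ 0 \in C, {in C &, forall u v, u + v \in C} & forall a, {in C, forall v, a *: v \in C}]
  (is_code C).
Proof.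
apply: (iffP and3P) => -[h0 hD hZ]; split=> //.
- by move=> u v uC vC; have /forall_inP/(_ v vC) := forall_inP hD u uC.
- by move=> a v; apply: (forall_inP (forallP hZ a)).
- by apply/forall_inP => u uC; apply/forall_inP => v vC; apply: hD.
- by apply/forallP => a; apply/forall_inP => v vC; apply: hZ.
Qed.

Lemma dual_codeP C u : reflect {in C, forall v, inner u v = 0} (u \in dual_code C).
Proof.
rewrite inE; apply: (iffP forall_inP) => h v /h; first by move/eqP.
by move=> ->.
Qed.

Lemma cyclic_iter C u k : is_cyclic_code C -> u \in C ->
  exists2 v, v \in C & of_row v = x ^+ k * of_row u.
Proof.
move=> /andP[_ /forall_inP hC] uC; elim: k => [|k [v vC hv]].
  by exists u; rewrite ?mul1r.
by exists (cshift v); [apply: hC | rewrite of_row_cshift hv exprS mulrA].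
Qed.

(* For a cyclic code the orthogonality relation upgrades from the trace of
   u v^* to the product itself, because the trace form is nondegenerate. *)
Lemma cyclic_dualP C u : is_cyclic_code C ->
  reflect {in C, forall v, of_row u * star (of_row v) = 0} (u \in dual_code C).
Proof.
move=> hC; apply: (iffP (dual_codeP C u)) => h v vC; last first.
  by rewrite inner_of_row h // linear0.
apply: cyc_alg_ext => k; rewrite mulr0 linear0.
(* Shifting [m * k] times multiplies by the star of x^k, which the second star in the inner product
   turns back into x^k. *)
have [w wC hw] := cyclic_iter (m * k) hC vC.
rewrite -(h w wC) inner_of_row hw rmorphM /= -starX starK.
by congr cyc_tr; rewrite mulrCA.
Qed.

End CyclicCodes.

(** * Reduction modulo gamma; the case where -1 is a power of q *)

Section CyclicSelfDual.
Variables (R : finComUnitRingType) (gamma : R) (e p r m : nat).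
Notation n := m.+1.
Notation q := (p ^ r)%N.
Notation S := (cyc_alg R m).
Notation x := (cycX R m).
Notation g := (gamma%:A : S).
Hypothesis gamma_max : nonunits R = principal_ideal gamma.
Hypothesis gamma_nilp : nilpotency_index gamma e.
Hypothesis p_pr : prime p.
Hypothesis card_res : #|residue_classes gamma| = q.

Implicit Types a b u v w : S.

Lemma gammaX_alg k : g ^+ k = (gamma ^+ k)%:A.
Proof. by rewrite exprZn expr1n. Qed.

Lemma g_nilp : g ^+ e = 0.
Proof. by rewrite gammaX_alg gamma_nilp.1 scale0r. Qed.

Lemma cong_alg (c d : R) : cong gamma c d -> cong g c%:A d%:A.
Proof.
by case=> w hw; exists w%:A; rewrite -scalerBl hw mulr_algl scalerA.
Qed.

Lemma cong_tr u v : cong g u v -> cong gamma (cyc_tr u) (cyc_tr v).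
Proof.
by case=> w hw; exists (cyc_tr w); rewrite -linearB hw mulr_algl linearZ.
Qed.

Lemma cong_star u v : cong g u v -> cong g (star u) (star v).
Proof.
by case=> w hw; exists (star w); rewrite -linearB hw !mulr_algl linearZ.
Qed.

Lemma cong_pchar_alg : cong g p%:R 0.
Proof.
have := cong_alg (cong_pchar gamma_max card_res).
by rewrite scale0r scaler_nat.
Qed.

(** The algebra is free over [R] on the powers of x, so the statement for [R] applies to each
    coefficient. *)
Lemma annihilator_gammaX_alg k u : (k <= e)%N -> gamma ^+ k *: u = 0 ->
  exists w, u = gamma ^+ (e - k) *: w.
Proof.
move=> ke; have [v ->] := of_row_surj u; rewrite -linearZ => h.
have /fin_all_exists[f hf] (i : 'I_n) : exists c : R, v 0 i = gamma ^+ (e - k) * c.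
  apply: (annihilator_gammaX gamma_max gamma_nilp ke).
  have := cyc_tr_of_row (gamma ^+ k *: v) i.
  by rewrite h mulr0 linear0 mxE => <-.
exists (of_row (\row_i f i)); rewrite -linearZ; congr of_row.
by apply/rowP => i; rewrite !mxE.
Qed.

Lemma cong_gammaX_alg_eq0 k u : (k < e)%N -> gamma ^+ k *: u = 0 -> cong g u 0.
Proof.
move=> ke h; have [w ->] := annihilator_gammaX_alg (ltnW ke) h.
exists (gamma ^+ (e - k).-1 *: w).
by rewrite subr0 mulr_algl scalerA -exprS prednK // subn_gt0.
Qed.

Lemma cong_fermat_alg (c : R) k : cong g (c%:A ^+ (q ^ k)) c%:A.
Proof.
apply: cong_iterX; rewrite exprZn expr1n; apply: cong_alg.
by rewrite -card_res; apply: cong_fermat.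
Qed.

Lemma cong_frob_row (v : 'rV[R]_n) k :
  cong g (of_row v ^+ (q ^ k)) (\sum_(i < n) v 0 i *: x ^+ (q ^ k * i)).
Proof.
rewrite -expnM; apply: cong_trans (cong_frob_sum p_pr cong_pchar_alg _ _ _ _) _.
apply: cong_sum => i _; rewrite expnM -[v 0 i *: x ^+ i]mulr_algl exprMn.
rewrite -[X in cong _ _ X]mulr_algl -exprM mulnC.
by apply: congM (cong_fermat_alg _ _) (cong_refl _ _).
Qed.

(** Modulo gamma the power q^i fixes coefficients and sends x to x^(q^i), which is x^m because q^i
    is -1, that is m, modulo n. *)
Lemma cong_star_frob i u : (n %| q ^ i + 1)%N -> cong g (u ^+ (q ^ i)) (star u).
Proof.
move=> hi; have [v ->] := of_row_surj u.
apply: cong_trans (cong_frob_row v i) _.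
rewrite /of_row rmorph_sum /=; apply: cong_sum => j _; rewrite linearZ /= starX !exprM.
suff -> : x ^+ (q ^ i) = x ^+ m by apply: cong_refl.
have h : q ^ i = m %[mod n].
  apply/eqP; rewrite -(eqn_modDr 1) [in X in _ == X]addn1 modnn; exact: hi.
by rewrite -(expr_mod _ (cycXn R m)) h expr_mod // cycXn.
Qed.

(* Modulo gamma, u^* is a power of u and u is a power of itself, hence no
   nonzero u satisfies u u^* = 0. *)
Lemma cong_mul_star_eq0 i u : (0 < i)%N -> (n %| q ^ i + 1)%N ->
  cong g (u * star u) 0 -> cong g u 0.
Proof.
move=> i0 hi h.
have h1 : cong g ((u ^+ (q ^ i)) ^+ (q ^ i)) u.
  apply: cong_trans (congX _ (cong_star_frob u hi)) _.
  by have := cong_star_frob (star u) hi; rewrite starK.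
have h2 : cong g (u ^+ (q ^ i).+1) 0.
  rewrite exprS; apply: cong_trans h; apply: congM (cong_refl _ _) _.
  exact: cong_star_frob.
apply: cong_trans (cong_sym h1) _; rewrite -exprM.
have q1 := card_residue_gt1 gamma_max p_pr card_res.
have Q1 : (1 < q ^ i)%N by rewrite -(exp1n i) ltn_exp2r.
have Q2 : ((q ^ i).+1 <= q ^ i * q ^ i)%N by nia.
by rewrite -(subnKC Q2) exprD; apply: cong0M.
Qed.

Lemma trivial_codeP (v : 'rV[R]_n) :
  reflect (exists w, of_row v = gamma ^+ e./2 *: w) (v \in trivial_code n gamma e).
Proof.
apply: (iffP imsetP) => [[w _ ->]|[w]]; first by exists (of_row w); rewrite linearZ.
have [w' ->] := of_row_surj w; rewrite -linearZ => /of_row_inj ->.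
by exists w'.
Qed.

Lemma self_dual_cyclic_trivial i (C : {set 'rV[R]_n}) :
  ~~ odd e -> (0 < i)%N -> (n %| q ^ i + 1)%N ->
  is_cyclic_code C -> self_dual C -> C = trivial_code n gamma e.
Proof.
move=> e_even i0 hi hC /eqP sdC.
have e2 : (e = e./2 + e./2)%N by rewrite addnn even_halfK.
have CT : {subset C <= trivial_code n gamma e}.
  move=> v vC; apply/trivial_codeP.
  suff: forall k, (k <= e./2)%N -> exists w, of_row v = gamma ^+ k *: w by apply.
  elim=> [|k IH] hk; first by exists (of_row v); rewrite scale1r.
  have [w hw] := IH (ltnW hk).
  have /(cyclic_dualP _ hC)/(_ v vC) : v \in dual_code C by rewrite -sdC.
  rewrite hw linearZ /= -scalerAl -scalerAr scalerA -exprD => h.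
  have /(cong_mul_star_eq0 i0 hi)[w'] : cong g (w * star w) 0.
    (* From [k < e./2] comes [k + k < e], so the power of gamma can be cancelled modulo gamma. *)
    by apply: cong_gammaX_alg_eq0 h; lia.
  by rewrite subr0 mulr_algl => ->; exists w'; rewrite scalerA exprSr.
(* For the other inclusion: products of two elements of gamma^(e/2) S vanish, so the trivial code is
   orthogonal to [C]. *)
apply/eqP; rewrite eqEsubset; apply/andP; split; apply/subsetP => // v.
move=> /trivial_codeP[w hw]; rewrite sdC; apply/(cyclic_dualP _ hC) => u.
move=> /CT/trivial_codeP[w' hw'].
rewrite hw hw' linearZ /= -scalerAl -scalerAr scalerA -exprD -e2.
by rewrite gamma_nilp.1 scale0r.
Qed.


(** * The converse: an idempotent moved by the involution, and the resulting code *)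

Lemma cong_frob_subC b (c : R) :
  cong g (b ^+ q) b -> cong g ((b - c%:A) ^+ q) (b - c%:A).
Proof.
move=> hb; have := cong_frob_sum p_pr cong_pchar_alg [:: b; - c%:A] xpredT id r.
rewrite !big_cons !big_nil !addr0 => h; apply: cong_trans h _.
by apply: congD hb _; rewrite -scaleNr -[q]expn1; apply: cong_fermat_alg.
Qed.

Lemma non_star_idempotent b : cong g (b ^+ q) b -> ~ cong g (b - star b) 0 ->
  exists2 E : S, E * E = E & star E != E.
Proof.
move=> hb hd; have q1 := card_residue_gt1 gamma_max p_pr card_res.
have r0 : (0 < r)%N by rewrite lt0n; apply: contraTneq q1 => ->.
(* [w c] lifts [b - c] so that its q-th power is exactly itself; then [w c ^+ q.-1] is a true
   idempotent. *)
pose w c := (b - c%:A) ^+ (p ^ (r * e)).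
have wq c : w c * w c ^+ q.-1 = w c.
  rewrite -exprS prednK; last exact: ltnW.
  rewrite /w exprAC; apply: (cong_exp_nilp p_pr cong_pchar_alg g_nilp).
    exact: leq_pmull.
  exact: cong_frob_subC.
have wb c : cong g (w c) (b - c%:A).
  by rewrite /w expnM; apply: cong_iterX; apply: cong_frob_subC.
have idem c : w c ^+ q.-1 * w c ^+ q.-1 = w c ^+ q.-1.
  have {1 3}-> : q.-1 = q.-2.+1 by lia.
  by rewrite exprSr -mulrA wq.
have [s hs] := prod_teichmuller gamma_max gamma_nilp p_pr card_res.
have [/allP fix_s|/allPn[c _ hc]] := boolP (all (fun c => star (w c ^+ q.-1) == w c ^+ q.-1) s);
  last by exists (w c ^+ q.-1).
case: hd; set d := b - star b.
(* Write f for [w c ^+ q.-1]. It fixes [w c] under multiplication, and also [star (w c)] because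
   [star f = f]; so it fixes their difference, which is congruent to [d]. *)
have dw c : c \in s -> cong g (d * (b - c%:A) ^+ q.-1) d.
  move=> cs; have wd : cong g (w c - star (w c)) d.
    have := congB (wb c) (cong_star (wb c)).
    by rewrite linearB /= star_alg opprB addrA subrK.
  apply: cong_trans (wd); apply: cong_trans (congM (cong_sym wd) (cong_sym (congX _ (wb c)))) _.
  rewrite mulrBl wq -{1}(eqP (fix_s c cs)) -rmorphM /= wq; exact: cong_refl.
have dprod : cong g (d * \prod_(c <- s) (b - c%:A) ^+ q.-1) d.
  elim: s dw {hs fix_s} => [|c s IH] dw; first by rewrite big_nil mulr1; apply: cong_refl.
  rewrite big_cons mulrA; apply: cong_trans (congM (dw c (mem_head _ _)) (cong_refl _ _)) _.
  by apply: IH => c' cs; apply: dw; rewrite inE cs orbT.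
apply: cong_trans (cong_sym dprod) _; rewrite prodrXl mulrC; apply: cong0M.
have -> : \prod_(c <- s) (b - c%:A) = b ^+ q - b.
  have := congr1 (horner_alg b) hs; rewrite rmorphB rmorphXn rmorph_prod /= horner_algX => ->.
  by apply: eq_bigr => c _; rewrite rmorphB /= horner_algX horner_algC.
have -> : q.-1 = q.-2.+1 by lia.
rewrite exprS; apply: cong0M; case: hb => z hz; exists z; by rewrite subr0.
Qed.

Lemma orthogonal_idempotent (E : S) : E * E = E -> star E != E ->
  exists a, [/\ a * a = a, a * star a = 0 & a != 0].
Proof.
move=> EE nE; exists (E * (1 - star E)).
have sE : star E * star E = star E by rewrite -rmorphM /= EE.
split.
- have -> : E * (1 - star E) * (E * (1 - star E))
     = (E * E) * (1 - star E - star E + star E * star E) by ring.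
  by rewrite EE sE; ring.
- rewrite rmorphM rmorphB rmorph1 /= starK.
  have -> : E * (1 - star E) * (star E * (1 - E))
     = (E - E * E) * (star E - star E * star E) by ring.
  by rewrite EE sE !subrr mulr0.
(* If [a = 0] then [E = E * star E], which is invariant under [star]. *)
- apply: contraNneq nE; rewrite mulrBr mulr1 => /eqP; rewrite subr_eq0 => /eqP h.
  by rewrite {1}h rmorphM /= starK mulrC -h.
Qed.

(** With [M] the order of q modulo n, the q-th power permutes the terms of [b] cyclically. The
    coefficient of x separates [b] from [star b]: it is 1 in the former and 0 in the latter. *)
Lemma cyclotomic_sum : coprime n p ->
  (forall i, (0 < i)%N -> ~~ (n %| q ^ i + 1)%N) ->
  exists2 b, cong g (b ^+ q) b & ~ cong g (b - star b) 0.
Proof.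
move=> cop hn.
have ex : exists k, (0 < k)%N && (q ^ k == 1 %[mod n]).
  exists (totient n); rewrite totient_gt0 /=; apply/eqP/Euler_exp_totient.
  by rewrite coprime_sym coprimeXr.
have [M /andP[M0 /eqP hM] minM] := ex_minnP ex.
have xM : x ^+ (q ^ M) = x by rewrite -(expr_mod _ (cycXn R m)) hM expr_mod ?cycXn.
exists (\sum_(i < M) x ^+ (q ^ i)).
  apply: cong_trans (cong_frob_sum p_pr cong_pchar_alg _ _ _ _) _.
  under eq_bigr do rewrite -exprM -expnSr.
  rewrite -(big_mkord xpredT (fun i => x ^+ (q ^ i.+1))).
  rewrite -(big_mkord xpredT (fun i => x ^+ (q ^ i))).
  case: M M0 {hM minM} xM => // M _ xM.
  by rewrite big_nat_recr //= xM [X in cong _ _ X]big_nat_recl //= addrC; apply: cong_refl.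
(* [m] is coprime to n and can be cancelled. *)
have m_n i : (n %| m + m * q ^ i)%N = (n %| q ^ i + 1)%N.
  by rewrite -mulnS Gauss_dvdr ?addn1 // coprime_sym coprimenS.
move=> /(congM (cong_refl g (x ^+ m)))/cong_tr; rewrite mulr0 linear0.
rewrite mulrBr linearB /= rmorph_sum !mulr_sumr.
rewrite [X in X - _]raddf_sum [X in _ - X]raddf_sum /= [X in _ - X]big1 => [|i _].
  case: M M0 {hM xM} minM => // M _ minM.
  rewrite big_ord_recl /= -exprD expn0 addn1 cyc_trX dvdnn big1 => [|i _].
    by rewrite addr0 subr0 => /(nonunitP gamma_max); rewrite unitr1.
  rewrite -exprD cyc_trX; case: (boolP (n %| _)%N) => // hi.
  (* A second term contributing to the coefficient of x would give a smaller period than [M]. *)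
  have /minM : (0 < bump 0 i)%N && (q ^ bump 0 i == 1 %[mod n]).
    by rewrite /bump /= -(eqn_modDl m) addn1 modnn.
  by rewrite ltnNge /bump /= add1n ltn_ord.
rewrite starX -exprD cyc_trX m_n; case: i => -[|i] iM /=; last first.
  by rewrite (negPf (hn i.+1 _)).
(* The hypothesis covers positive exponents only, so exponent 0 is replaced by the period [M]. *)
suff -> : (n %| q ^ 0 + 1)%N = (n %| q ^ M + 1)%N by rewrite (negPf (hn M M0)).
by rewrite /dvdn -(modnDml (q ^ M)) hM modnDml.
Qed.

Lemma nontrivial_self_dual a : ~~ odd e ->
  a * a = a -> a * star a = 0 -> a != 0 ->
  exists C : {set 'rV[R]_n},
      [/\ is_cyclic_code C, self_dual C & C != trivial_code n gamma e].
Proof.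
move=> e_even aa as0 a0.
have e0 := nilpotency_index_gt0 gamma_nilp.
pose h := e./2.-1.
have h2 : e./2 = h.+1.
  by rewrite /h prednK //; case: e e0 e_even => [|[]].
have eE : e = (h.+2 + h)%N by have := even_halfK e_even; rewrite h2 -addnn; lia.
have eE' : e = (h.+1 + h.+1)%N by rewrite eE addSnnS.
have sa : star a * star a = star a by rewrite -rmorphM /= aa.
pose d := 1 - a - star a.
have sd : star d = d by rewrite /d !rmorphB rmorph1 /= starK addrAC.
have ad : a * d = 0 by rewrite /d !mulrBr mulr1 aa as0 subr0 subrr.
have sad : star a * d = 0 by rewrite -sd -rmorphM /= ad rmorph0.
have dd : d * d = d by rewrite {1}/d !mulrBl mul1r ad sad !subr0.
(* The ideal is cut out by annihilators: the components along [a], [star a] and [d] are multiples of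
   gamma to the powers h, h + 2 and h + 1. *)
pose C := [set v : 'rV[R]_n | [&& gamma ^+ h.+2 *: (a * of_row v) == 0,
  gamma ^+ h *: (star a * of_row v) == 0 & gamma ^+ h.+1 *: (d * of_row v) == 0]].
have CP (v : 'rV[R]_n) : reflect [/\ gamma ^+ h.+2 *: (a * of_row v) = 0,
    gamma ^+ h *: (star a * of_row v) = 0 & gamma ^+ h.+1 *: (d * of_row v) = 0]
    (v \in C).
  by rewrite inE; apply: (iffP and3P) => [[/eqP ? /eqP ? /eqP ?]|[-> -> ->]].
have cycC : is_cyclic_code C.
  apply/andP; split; [apply/is_codeP; split|].
  - by apply/CP; rewrite linear0 !mulr0 !scaler0.
  - move=> u v /CP[u1 u2 u3] /CP[v1 v2 v3]; apply/CP.
    by rewrite linearD /= !mulrDr !scalerDr u1 u2 u3 v1 v2 v3 !addr0.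
  - move=> c v /CP[v1 v2 v3]; apply/CP; rewrite linearZ /= -!scalerAr.
    by split; rewrite scalerA mulrC -scalerA ?v1 ?v2 ?v3 scaler0.
  - apply/forall_inP => v /CP[v1 v2 v3]; apply/CP; rewrite of_row_cshift.
    by split; rewrite mulrCA scalerAr ?v1 ?v2 ?v3 mulr0.
have ge0 k l : (k + l)%N = e -> gamma ^+ k * gamma ^+ l = 0.
  by rewrite -exprD => ->; exact: gamma_nilp.1.
exists C; split=> //.
- apply/eqP/setP => v; apply/idP/(cyclic_dualP _ cycC) => [/CP[v1 v2 v3] u /CP[u1 u2 u3]|hv].
    have [|A hA] := annihilator_gammaX_alg _ v1; first by lia.
    have [|B hB] := annihilator_gammaX_alg _ v2; first by lia.
    have [|D hD] := annihilator_gammaX_alg _ v3; first by lia.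
    have [|A' hA'] := annihilator_gammaX_alg _ u1; first by lia.
    have [|B' hB'] := annihilator_gammaX_alg _ u2; first by lia.
    have [|D' hD'] := annihilator_gammaX_alg _ u3; first by lia.
    set V := of_row v in v1 v2 v3 hA hB hD *; set U := of_row u in u1 u2 u3 hA' hB' hD' *.
    (* The involution swaps [a] and [star a], so a component of level h always meets one of level h
       + 2, and the [d] components meet at h + 1; every product carries gamma^e. *)
    have -> : V * star U = (a * V) * star (star a * U) + (star a * V) * star (a * U)
        + (d * V) * star (d * U).
      rewrite !rmorphM /= starK sd.
      transitivity (V * star U * (a * a + star a * star a + d * d)); last by ring.
      by rewrite aa sa dd /d; ring.
    rewrite hA hB hD hA' hB' hD' !linearZ /= -!scalerAl -!scalerAr !scalerA.
    by rewrite !ge0 ?scale0r ?addr0 //; lia.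
  (* Conversely, pairing [v] with the generators of [C] recovers the three annihilator
     conditions. *)
  have test k (w : S) : (exists2 v', v' \in C & of_row v' = gamma ^+ k *: star w) ->
      gamma ^+ k *: (w * of_row v) = 0.
    case=> v' /hv; move=> + hv'; rewrite hv' linearZ /= starK -scalerAr mulrC => <- //.
  apply/CP; split; apply: test.
  + have [v' hv'] := of_row_surj (gamma ^+ h.+2 *: star a); exists v' => //.
    apply/CP; rewrite -hv' -!scalerAr as0 sa !scalerA [d * _]mulrC sad !scaler0.
    by rewrite ge0 ?scale0r //; lia.
  + have [v' hv'] := of_row_surj (gamma ^+ h *: star (star a)); exists v' => //.
    apply/CP; rewrite -hv' starK -!scalerAr [star a * _]mulrC as0 aa !scalerA [d * _]mulrC ad.
    by rewrite !scaler0 ge0 ?scale0r //; lia.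
  + have [v' hv'] := of_row_surj (gamma ^+ h.+1 *: star d); exists v' => //.
    apply/CP; rewrite -hv' sd -!scalerAr ad sad dd !scaler0 !scalerA.
    by rewrite ge0 ?scale0r //; lia.
(* This word separates [C] from the trivial code: if gamma^h a were in gamma^(h+1) S, then [a] would
   vanish modulo gamma, and an idempotent with that property is 0. *)
- have [v hv] := of_row_surj (gamma ^+ h *: a).
  have vC : v \in C.
    apply/CP; rewrite -hv -!scalerAr [star a * _]mulrC as0 aa !scalerA [d * _]mulrC ad.
    by rewrite !scaler0 ge0 ?scale0r //; lia.
  apply/eqP => CT; move: vC; rewrite CT => /trivial_codeP[w]; rewrite -hv h2 => hw.
  have : cong g a 0.
    apply: (@cong_gammaX_alg_eq0 (h.+1 + h)); first by lia.
    by rewrite exprD -scalerA hw scalerA ge0 ?scale0r //.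
  move/(cong_exp_nilp p_pr cong_pchar_alg g_nilp (leqnn e)) => /eqP.
  have aX k : a ^+ k.+1 = a by elim: k => // k IH; rewrite exprS IH.
  have -> : (p ^ e)%N = (p ^ e).-1.+1 by rewrite prednK // expn_gt0 prime_gt0.
  by rewrite aX expr0n (negPf a0).
Qed.

End CyclicSelfDual.

Lemma eqz_mod_opp1 (n k : nat) : (k%:Z = - 1 %[mod n%:Z])%Z <-> (n %| k + 1)%N.
Proof.
by split=> [/eqP|h]; [|apply/eqP]; rewrite eqz_mod_dvd opprK -PoszD.
Qed.

Theorem mainTheorem7 (R : finComUnitRingType) (gamma : R) (e p r n : nat) :
  is_chain_ring R ->
  nonunits R = principal_ideal gamma ->
  nilpotency_index gamma e ->
  ~~ odd e ->
  prime p ->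
  #|residue_classes gamma| = (p ^ r)%N ->
  (0 < n)%N ->
  coprime n p ->
  (exists C : {set 'rV[R]_n},
      [/\ is_cyclic_code C, self_dual C & C != trivial_code n gamma e])
  <->
  (forall i : nat, (0 < i)%N -> ~ (((p ^ r) ^ i)%:Z = - 1 %[mod n%:Z])%Z).
Proof.
case: n => // m _ gmax gnil e_even p_pr hq _ cop.
split=> [[C [cycC sdC ntC]] i i0 /eqz_mod_opp1 hi | hn].
  by rewrite (self_dual_cyclic_trivial gmax gnil p_pr hq e_even i0 hi cycC sdC) eqxx in ntC.
have [i i0|b hb hd] := cyclotomic_sum gmax p_pr hq cop.
  by apply/negP => /eqz_mod_opp1; apply: hn.
have [E EE nE] := non_star_idempotent gmax gnil p_pr hq hb hd.
have [a [aa as0 a0]] := orthogonal_idempotent EE nE.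
exact: (nontrivial_self_dual gmax gnil p_pr hq e_even aa as0 a0).
Qed.
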